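(* Let $n,m$ be positive integers, $\mathbf a\in\mathbb N^n$ with $a_1>0$, and $d\in\{0,1,\dots,nm\}$. If $m>1$, then $$f_d^{(n,m)}(\mathbf a)=\sum_{\mathbf j\in\{0,1\}^n}\sum_{k=0}^d\binom{\beta_{\mathbf j,\mathbf a}}{k}f^{(n,m-1)}_{d-k-\gamma_{\mathbf j,\mathbf a}}(\mathbf j).$$ For $m=1$ and every $\mathbf j\in\{0,1\}^n$, $$f_d^{(n,1)}(\mathbf j)=[x^{d+k}]\prod_{i=1}^k\bigl((x+1)^{c_i+1}-1\bigr),$$ where $(c_1,\dots,c_k)=\mathrm{sgn}(\mathbf j)$.
   Context: $G(n,m)$ is the directed graph with vertex set $\{(i,j):1\le i\le n,0\le j\le m\}\cup\{s\}$ and edges $((i,j),(i,j+1))$ ($1\le i\le n$, $0\le j\le m-1$), $((i,j),(i+1,j))$ ($1\le i\le n-1$, $0\le j\le m$), $((n,j),s)$ ($0\le j\le m$). For $\mathbf a\in\mathbb N^n$, $\mathcal F_{G(n,m)}(\mathbf a)$ is the polytope of nonnegative real edge weightings whose outflow minus inflow is $a_i$ at $(i,0)$, $-\sum_i a_i$ at $s$, and $0$ elsewhere; $f_d^{(n,m)}(\mathbf a)$ is its number of $d$-dimensional faces, and $f_e:=0$ for $e<0$. Block structure: if $p_1=1<p_2<\dots<p_\ell$ are the indices with $a_{p_t}>0$ and $p_{\ell+1}:=n+1$, the blocks of $\mathbf j$ according to $\mathbf a$ are $B_t=(j_{p_t},\dots,j_{p_{t+1}-1})$, $t=1,\dots,\ell$.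 $\beta_{\mathbf j,\mathbf a}$ is the number of blocks containing at least one $1$, $b_{\mathbf j}$ is the total number of $1$'s in $\mathbf j$, and $\gamma_{\mathbf j,\mathbf a}=b_{\mathbf j}-\beta_{\mathbf j,\mathbf a}$. Signature: for a vector $\mathbf v$ with $v_1>0$, $\mathrm{sgn}(\mathbf v)=(c_1,\dots,c_k)$ where $\mathbf v=( *,0^{c_1-1},*,0^{c_2-1},\dots,*,0^{c_k-1})$, each $*$ a positive entry; for $\mathbf j\in\{0,1\}^n$ with leading zeros, $\mathrm{sgn}(\mathbf j)$ is the signature of $\mathbf j$ with its leading zeros deleted, and for $\mathbf j=\mathbf 0$ it is empty ($k=0$, empty product $=1$). $[x^r]P$ denotes the coefficient of $x^r$ in $P$. *)

(* Defs.v *)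
From HB Require Import structures.
From mathcomp Require Import all_boot all_order all_algebra.
From mathcomp Require Import finmap.
From mathcomp Require Import boolp classical_sets cardinality.
From mathcomp Require Import Rstruct.
Set Implicit Arguments. Unset Strict Implicit. Unset Printing Implicit Defensive.
Import Order.TTheory GRing.Theory Num.Theory.

Local Open Scope classical_set_scope.
Local Open Scope ring_scope.

Notation RR := Rdefinitions.R.

(* ---------- The graph G(n,m) (0-based indices) ----------
   vertex (i,j), 0 <= i < n, 0 <= j <= m is  Some (i,j);  the sink s is None. *)
Definition gvertex (n m : nat) := option ('I_n * 'I_m.+1).

Definition is_gedge (n m : nat) (e : gvertex n m * gvertex n m) : bool :=
  match e with
  | (Some (i, j), Some (i', j')) =>
      ((i == i') && (nat_of_ord j' == j.+1)) ||
      ((j == j') && (nat_of_ord i' == i.+1))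
  | (Some (i, j), None) => (i.+1 == n)%N
  | _ => false
  end.

Definition gedge (n m : nat) := {e : gvertex n m * gvertex n m | is_gedge e}.

Definition etail n m (e : gedge n m) : gvertex n m := (val e).1.
Definition ehead n m (e : gedge n m) : gvertex n m := (val e).2.

Definition netflow n m (a : 'I_n -> nat) (v : gvertex n m) : RR :=
  match v with
  | Some (i, j) => if nat_of_ord j == 0%N then (a i)%:R else 0
  | None => - (\sum_(i < n) a i)%:R
  end.

Definition wvec n m := {ffun gedge n m -> RR}.

Definition flow_polytope n m (a : 'I_n -> nat) : set (wvec n m) :=
  [set x : wvec n m | (forall e, 0 <= x e) /\
     (forall v : gvertex n m,
        \sum_(e | etail e == v) x e - \sum_(e | ehead e == v) x e = netflow a v)].

Definition dotp n m (c x : wvec n m) : RR := \sum_e c e * x e.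

(* F is a face of P: the intersection of P with a supporting hyperplane
   (c = 0 gives P itself); we additionally require faces to be nonempty
   when counting, so that dimensions are >= 0. *)
Definition is_face n m (P F : set (wvec n m)) : Prop :=
  exists (c : wvec n m) (t : RR),
    (forall x, P x -> dotp c x <= t) /\ F = [set x : wvec n m | P x /\ dotp c x = t].

(* the same vectors, viewed in the vector space {ffun gedge -> RR^o} over RR *)
Definition ovec n m := {ffun gedge n m -> RR^o}.
Definition tov n m (x : wvec n m) : ovec n m := [ffun e => x e].

Definition has_dim n m (F : set (wvec n m)) (k : nat) : Prop :=
  exists s : seq (ovec n m),
    (forall v, v \in s -> exists x y, F x /\ F y /\ v = tov (x - y)) /\
    (forall x y, F x -> F y -> tov (x - y) \in <<s>>%VS) /\
    \dim <<s>>%VS = k.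

Definition faces_of_dim n m (P : set (wvec n m)) (d : nat) : set (set (wvec n m)) :=
  [set F : set (wvec n m) | is_face P F /\ F !=set0 /\ has_dim F d].

Definition fnum (n m : nat) (a : 'I_n -> nat) (d : nat) : nat :=
  #|` fset_set (faces_of_dim (@flow_polytope n m a) d) |%fset.

Definition fnumZ (n m : nat) (a : 'I_n -> nat) (e : int) : nat :=
  match e with Posz k => @fnum n m a k | Negz _ => 0%N end.

Definition inblock n (a : 'I_n -> nat) (p i : 'I_n) : bool :=
  (p <= i)%N && [forall q : 'I_n, ((p < q)%N && (q <= i)%N) ==> (a q == 0%N)].

Definition beta n (j : {ffun 'I_n -> bool}) (a : 'I_n -> nat) : nat :=
  #|[set p : 'I_n | (0 < a p)%N && [exists i : 'I_n, j i && inblock a p i]]|.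

Definition bones n (j : {ffun 'I_n -> bool}) : nat := #|[set i : 'I_n | j i]|.

Definition gamma n (j : {ffun 'I_n -> bool}) (a : 'I_n -> nat) : int :=
  (bones j)%:Z - (beta j a)%:Z.

Definition natv n (j : {ffun 'I_n -> bool}) : 'I_n -> nat := fun i => nat_of_bool (j i).

(* ---------- signature ----------
   positions x_1 < ... < x_k of the ones of j (leading zeros play no role);
   sgn(j) = (x_2 - x_1, ..., x_k - x_{k-1}, n - x_k), empty if j = 0. *)
Definition sgn n (j : {ffun 'I_n -> bool}) : seq nat :=
  match [seq nat_of_ord i | i <- enum 'I_n & j i] with
  | [::] => [::]
  | x1 :: rest => pairmap (fun x y => y - x)%N x1 (rcons rest n)
  end.

(* Main.v *)
(** A nonempty face of the flow polytope is determined by the largest support S of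
    its points.  Since G(n,m) is acyclic, the edge sets occurring as supports are
    those in which a vertex other than s has an outgoing edge exactly when it is a
    source or has an incoming edge; the face then has dimension
    the sum over the vertices of (outdegree in S) - 1, that is, the number of
    vertices both of whose outgoing edges lie in S.

    Such an S can be read column by column.  If j marks the right edges leaving the
    first column, then in a block of a without ones the flow has to run down the
    whole block, while in a block with ones all ones but the last branch, and the
    last one may or may not branch.  So the first column contributes
    x^gamma (1+x)^beta, and the other columns form a support for G(n,m-1) and j.
    For m = 1 the second column is forced, and summing over j gives
    1 + (1+x)((1+x)^c - 1)/x = ((1+x)^(c+1) - 1)/x for each block of length c. *)

Require Import Defs.
From HB Require Import structures.
From mathcomp Require Import all_boot all_order all_algebra.
From mathcomp Require Import finmap.
From mathcomp Require Import boolp classical_sets cardinality.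
From mathcomp Require Import Rstruct.
From mathcomp Require Import zify ring lra.
Import Order.TTheory GRing.Theory Num.Theory.
Local Open Scope ring_scope.

(** * Supports and faces *)

Section FlowPolytope.
Context {n m : nat}.
Notation E := (gedge n m).
Notation V := (gvertex n m).
Implicit Types (e f : E) (v : V) (S T : {set E}) (x y z : E -> RR).

(** * Acyclicity: induction and recursion along edges *)

Definition vrank v : nat := if v is Some (i, j) then (i + j)%N else (n + m)%N.

Lemma vrank_edge e : (vrank (etail e) < vrank (ehead e))%N.
Proof.
case: e => [[[[i j]|] [[i' j']|]] //=]; rewrite /etail /ehead /=.
- case/orP=> /andP[/eqP<- /eqP->]; lia.
- by move=> /eqP ni; have := ltn_ord j; lia.
Qed.

Lemma etail_neq_sink e : etail e != None.
Proof. by case: e => [[[[i j]|] v] //]. Qed.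

Lemma edge_ind (P : E -> Prop) :
  (forall e, (forall f, ehead f = etail e -> P f) -> P e) -> forall e, P e.
Proof.
move=> IH e; have [k] := ubnP (vrank (etail e)).
elim: k e => // k IHk e le_ek; apply: IH => f hf; apply: IHk.
by have := vrank_edge f; rewrite hf; lia.
Qed.

(** The hypothesis makes the value at an edge depend only on the edges entering its tail. Iterating
    [Phi] from zero, that value is stable once the number of steps exceeds the rank of the tail, so
    finitely many steps reach a fixed point. *)
Lemma causal_fixpoint (Phi : (E -> RR) -> E -> RR) :
  (forall x y e, (forall f, ehead f = etail e -> x f = y f) ->
     Phi x e = Phi y e) ->
  exists x, forall e, x e = Phi x e.
Proof.
move=> causal; pose it k := iter k Phi (fun=> 0).
have stable k e : (vrank (etail e) < k)%N -> it k e = it k.+1 e.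
  elim: k e => // k IHk e ltek; apply: causal => f hf; apply: IHk.
  by have := vrank_edge f; rewrite hf; lia.
exists (it (n + m).+1) => e; apply: stable.
have := vrank_edge e; have : (vrank (ehead e) <= n + m)%N.
  rewrite /vrank; case: (ehead e) => [[i j]|//].
  by have := ltn_ord i; have := ltn_ord j; lia.
lia.
Qed.

(** * Flow conservation and supports *)

Definition outflow x v := \sum_(e | etail e == v) x e.
Definition inflow x v := \sum_(e | ehead e == v) x e.

Definition source (a : 'I_n -> nat) v : bool :=
  if v is Some (i, j) then (nat_of_ord j == 0%N) && (0 < a i)%N else false.

Lemma netflow_ge0 a v : v != None -> 0 <= netflow a v :> RR.
Proof. by case: v => [[i j]|//] _ /=; case: ifP => // _; rewrite ler0n. Qed.

Lemma netflow_neq0 a v : v != None -> (netflow a v != 0) = source a v.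
Proof.
case: v => [[i j]|//] _ /=; case: ifP => _; last by rewrite eqxx.
by rewrite pnatr_eq0 lt0n.
Qed.

Lemma sum_vertex (F : V -> RR) : \sum_v F v = F None + \sum_(v | v != None) F v.
Proof. by rewrite (bigD1 None). Qed.

Lemma netflow_sum a : \sum_(v : V) netflow a v = 0 :> RR.
Proof.
rewrite sum_vertex /=; apply/eqP; rewrite addrC subr_eq0; apply/eqP.
transitivity (\sum_(p : 'I_n * 'I_m.+1) netflow a (Some (p.1, p.2))).
  rewrite (reindex_omap (fun p : 'I_n * 'I_m.+1 => Some p) id); last by case.
  by apply: eq_big => [p|[i j] _]; rewrite /= ?eqxx.
rewrite -(pair_bigA _ (fun (i : 'I_n) (j : 'I_m.+1) => netflow a (Some (i, j)))) /=.
rewrite natr_sum; apply: eq_bigr => i _.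
by rewrite big_ord_recl /= big1 ?addr0.
Qed.

Lemma balance_sum x : \sum_v (outflow x v - inflow x v) = 0.
Proof.
have part (p : E -> V) : \sum_v \sum_(e | p e == v) x e = \sum_e x e.
  by rewrite [RHS](partition_big p xpredT).
by rewrite sumrB !part subrr.
Qed.

(** Every edge leaves one vertex and enters one, so the excesses add up to zero and the equation at
    the sink follows from the others. Weightings built by recursion need checking only away from the
    sink. *)
Lemma balance_sink x (b : V -> RR) : \sum_v b v = 0 ->
  (forall v, v != None -> outflow x v - inflow x v = b v) ->
  forall v, outflow x v - inflow x v = b v.
Proof.
move=> b0 bal v; have [->|/bal//] := eqVneq v None.
have := balance_sum x; rewrite -[RHS]b0 !sum_vertex (eq_bigr _ bal) => eqS.
exact: (addIr _ eqS).
Qed.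

Lemma psum_neq0_exists x (P : pred E) : (forall e, 0 <= x e) ->
  (\sum_(e | P e) x e != 0) = [exists e in [set e | x e != 0], P e].
Proof.
move=> x0; apply/idP/existsP.
  move=> /eqP nz; apply: contrapT => H; apply: nz; apply: big1 => e Pe.
  apply/eqP/negPn/negP => xe; apply: H; exists e; by rewrite inE xe.
case=> e /andP[]; rewrite inE => xe Pe; apply: contra xe => /eqP s0.
by apply/eqP; apply: (psumr_eq0P _ s0).
Qed.

(** This is flow conservation with each quantity replaced by whether it is nonzero. *)
Definition is_support (a : 'I_n -> nat) S : bool :=
  [forall v, (v != None) ==>
    (source a v || [exists e in S, ehead e == v] == [exists e in S, etail e == v])].

Lemma is_supportP a S v : is_support a S -> v != None ->
  source a v || [exists e in S, ehead e == v] = [exists e in S, etail e == v].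
Proof. by move=> /forallP/(_ v)/implyP H /H/eqP. Qed.

(** Away from the sink, the outflow is net flow plus inflow, both nonnegative, so it is nonzero
    exactly when one of them is. *)
Lemma support_of_flow a (x : wvec n m) : flow_polytope a x ->
  is_support a [set e | x e != 0].
Proof.
case=> x0 bal; apply/forallP => v; apply/implyP => vs.
rewrite -!(psum_neq0_exists x) // -netflow_neq0 // -negb_and -paddr_eq0 //.
- by rewrite -(bal v) subrK.
- exact: netflow_ge0.
- exact: sumr_ge0.
Qed.

Lemma support_realized a S : is_support a S ->
  exists x : wvec n m, flow_polytope a x /\ [set e | x e != 0] = S.
Proof.
move=> valS.
(* every vertex distributes its inflow equally among its outgoing edges in S *)
pose deg v := \sum_(e | etail e == v) ((e \in S)%:R : RR).
pose Phi x e : RR :=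
  (e \in S)%:R * (netflow a (etail e) + inflow x (etail e)) / deg (etail e).
have [x xE] : exists x, forall e, x e = Phi x e.
  apply: causal_fixpoint => x y e xy; rewrite /Phi /inflow.
  by congr (_ * (_ + _) / _); apply: eq_bigr => f /eqP/xy.
have deg_gt0 v : [exists e in S, etail e == v] -> 0 < deg v.
  case/existsP => e /andP[eS tv].
  rewrite /deg (bigD1 e) //= eS ltr_pwDl // sumr_ge0 // => f _; exact: ler0n.
have x_ge0_supp e : 0 <= x e /\ (x e != 0) = (e \in S).
  elim/edge_ind: e => e IH; rewrite xE /Phi.
  have in0 : 0 <= inflow x (etail e) by apply: sumr_ge0 => f /eqP/IH[].
  have net0 := netflow_ge0 a _ (etail_neq_sink e).
  case: (boolP (e \in S)) => eS; last by rewrite !mul0r eqxx.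
  rewrite mul1r; have dg : 0 < deg (etail e).
    by apply: deg_gt0; apply/existsP; exists e; rewrite eS eqxx.
  split; first by rewrite divr_ge0 ?addr_ge0 // ltW.
  apply: mulf_neq0; last by rewrite invr_eq0 gt_eqF.
  rewrite paddr_eq0 // negb_and.
  rewrite netflow_neq0 ?etail_neq_sink //.
  have : [exists f in S, etail f == etail e] by apply/existsP; exists e; rewrite eS eqxx.
  rewrite -(is_supportP a) ?etail_neq_sink // => /orP[->//|/existsP[f /andP[fS hf]]].
  apply/orP; right; apply/eqP => /psumr_eq0P H.
  have [_] := IH f (eqP hf); rewrite fS H ?eqxx //.
  by move=> g /eqP/IH[].
pose w : wvec n m := [ffun e => x e].
exists w; split; last first.
  by apply/setP => e; rewrite inE ffunE; case: (x_ge0_supp e).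
split; first by move=> e; rewrite ffunE; case: (x_ge0_supp e).
move=> v; transitivity (outflow x v - inflow x v).
  by rewrite /outflow /inflow; congr (_ - _); apply: eq_bigr => e _; rewrite ffunE.
apply: balance_sink v => [|v vs]; first exact: netflow_sum.
(* The quotient is left uncancelled, so that the equation also covers vertices where [deg v] is
   zero; there net flow and inflow both vanish. *)
have -> : outflow x v = deg v * ((netflow a v + inflow x v) / deg v).
  rewrite /outflow /deg mulr_suml; apply: eq_bigr => e /eqP tv.
  by rewrite xE /Phi tv mulrA.
case: (boolP [exists e in S, etail e == v]) => act.
  rewrite mulrC divfK ?addrK // gt_eqF //; exact: deg_gt0.
have := act; rewrite -(is_supportP a) // negb_or -netflow_neq0 // negbK.
case/andP => /eqP -> /existsPn noin.
have -> : inflow x v = 0.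
  apply: big1 => e hv; apply/eqP; apply/negPn; case: (x_ge0_supp e) => _ ->.
  by have := noin e; rewrite hv andbT.
by rewrite addr0 mul0r mulr0 subr0.
Qed.

(** * Nonempty faces correspond to supports *)

Definition support_face a S : set (wvec n m) :=
  [set x : wvec n m | flow_polytope a x /\ forall e, e \notin S -> x e = 0]%classic.

Lemma small_perturbation x z : (forall e, 0 <= x e) ->
  (forall e, z e != 0 -> x e != 0) ->
  exists2 t : RR, 0 < t & forall e, 0 <= x e + t * z e.
Proof.
(* [M] dominates every ratio of [|z e|] to [x e], and the summand 1 keeps it positive. Where [x e]
   is zero, so is [z e]. *)
move=> x0 zx; pose M := 1 + \sum_e `|z e| / x e.
have t0 e : 0 <= `|z e| / x e by rewrite divr_ge0.
have M0 : 0 < M by rewrite ltr_pwDl // sumr_ge0.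
exists M^-1; first by rewrite invr_gt0.
move=> e; case: (eqVneq (z e) 0) => [->|ze]; first by rewrite mulr0 addr0.
have xe : 0 < x e by rewrite lt_def zx // x0.
have le : `|z e| <= M * x e.
  rewrite -ler_pdivrMr // /M (bigD1 e) //=.
  have : 0 <= \sum_(i | i != e) `|z i| / x i by apply: sumr_ge0.
  lra.
have : - (M^-1 * z e) <= x e.
  rewrite -mulrN -ler_pdivlMl ?invr_gt0 // invrK.
  by apply: le_trans (ler_norm _) _; rewrite normrN.
lra.
Qed.

Definition circulation z := forall v, outflow z v - inflow z v = 0.

Lemma circulation_diff a (x y : wvec n m) : flow_polytope a x -> flow_polytope a y ->
  circulation (fun e => x e - y e).
Proof.
move=> [_ xb] [_ yb] v; rewrite /outflow /inflow !sumrB.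
rewrite -[RHS](subrr (netflow a v)) -{1}(xb v) -(yb v); ring.
Qed.

Lemma flow_perturbation a (x : wvec n m) z (t : RR) : flow_polytope a x ->
  circulation z -> (forall e, 0 <= x e + t * z e) ->
  flow_polytope a ([ffun e => x e + t * z e] : wvec n m).
Proof.
move=> [_ xb] zb pos; split=> [e|v]; first by rewrite ffunE.
transitivity (\sum_(e | etail e == v) (x e + t * z e) -
              \sum_(e | ehead e == v) (x e + t * z e)).
  by congr (_ - _); apply: eq_bigr => e _; rewrite ffunE.
rewrite !big_split /= -!mulr_sumr -(xb v).
have := zb v; rewrite /outflow /inflow => /eqP; rewrite subr_eq0 => /eqP ->.
ring.
Qed.

Lemma dotp_perturbation (c x : wvec n m) z (t : RR) :
  dotp c ([ffun e => x e + t * z e] : wvec n m) = dotp c x + t * \sum_e c e * z e.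
Proof.
rewrite /dotp mulr_sumr -big_split /=; apply: eq_bigr => e _.
by rewrite ffunE; ring.
Qed.

Lemma support_face_is_face a S : is_face (flow_polytope a) (support_face a S).
Proof.
(* This functional is minus the total weight outside [S], hence at most 0 on the polytope, with
   equality exactly on the face. *)
pose c : wvec n m := [ffun e => - (e \notin S)%:R].
have cx (x : wvec n m) : dotp c x = - \sum_(e | e \notin S) x e.
  rewrite /dotp -sumrN [RHS]big_mkcond /=; apply: eq_bigr => e _.
  by rewrite ffunE; case: (e \in S); rewrite /= ?oppr0 ?mul0r ?mulN1r.
exists c, 0; split=> [x [x0 _]|]; first by rewrite cx oppr_le0 sumr_ge0.
apply/seteqP; split=> x /= [xP xS]; split=> //.
  by rewrite cx big1 ?oppr0.
move: xS; rewrite cx => /eqP; rewrite oppr_eq0 => /eqP xS e.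
by move: e; apply: psumr_eq0P xS => e _; case: xP.
Qed.

(** [S] is a largest support of a point of the face, attained at [x0]. A point of the face using an
    edge outside [S] would have, with [x0], a midpoint of larger support. Conversely, if [y]
    vanishes outside [S], then [x0] can be pushed slightly away from [y] within the polytope, which
    forces the functional to reach its bound at [y]. *)
Lemma face_support a F : is_face (flow_polytope a) F -> (F !=set0)%classic ->
  exists2 S, is_support a S & F = support_face a S.
Proof.
case=> c [t [ct ->]] [x1 /= Fx1]; set P := flow_polytope a in ct Fx1 *.
pose supp (x : wvec n m) := [set e | x e != 0].
pose Q S := `[< exists x : wvec n m, (P x /\ dotp c x = t) /\ supp x = S >].
have Q1 : Q (supp x1) by apply/asboolP; exists x1.
case: (arg_maxnP (fun S => #|S|) Q1) => S /asboolP[x0 [[Px0 cx0] Sx0]] maxS.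
exists S; first by rewrite -Sx0; apply: support_of_flow.
have x0S e : (x0 e != 0) = (e \in S) by rewrite -Sx0 inE.
apply/seteqP; split=> y /= [Py].
  move=> cy; split=> // e; apply: contraNeq => ye.
  have circ := circulation_diff _ _ _ Py Px0.
  (* The midpoint of [x0] and [y]; by nonnegativity its support is the union of theirs. *)
  pose w : wvec n m := [ffun e => x0 e + 2^-1 * (y e - x0 e)].
  have x0p e' : 0 <= x0 e' by case: Px0.
  have yp e' : 0 <= y e' by case: Py.
  have Pw : P w.
    by apply: flow_perturbation => // e'; have := x0p e'; have := yp e'; lra.
  have wE e' : w e' = 2^-1 * (x0 e' + y e') by rewrite ffunE; field.
  have cw : dotp c w = t.
    rewrite dotp_perturbation; under eq_bigr => i _ do rewrite mulrBr.
    by rewrite sumrB -/(dotp c y) -/(dotp c x0) cy cx0 subrr mulr0 addr0.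
  have /maxS cardle : Q (supp w) by apply/asboolP; exists w.
  have Sw : S \subset supp w.
    apply/fintype.subsetP => e' eS; rewrite inE wE mulf_neq0 ?invr_eq0 ?pnatr_eq0 //.
    by rewrite paddr_eq0 // negb_and x0S eS.
  have /eqP -> : S == supp w by rewrite eqEcard Sw.
  by rewrite inE wE mulf_neq0 ?invr_eq0 ?pnatr_eq0 // paddr_eq0 // negb_and ye orbT.
move=> yS; split=> //.
have circ := circulation_diff _ _ _ Px0 Py.
have [] := small_perturbation x0 (fun e => x0 e - y e).
- by case: Px0.
- by move=> e; apply: contra => /eqP xe; rewrite xe yS ?subr0 // -x0S xe eqxx.
move=> s s0 pos; have := ct _ (flow_perturbation _ _ _ _ Px0 circ pos).
rewrite dotp_perturbation.
under eq_bigr => i _ do rewrite mulrBr.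
rewrite sumrB -/(dotp c y) -/(dotp c x0) cx0 gerDl pmulr_rle0 // subr_le0 => tle.
by apply/eqP; rewrite eq_le tle ct.
Qed.

(** A flow with support exactly [S] lies in its own face, and it lies in that of [T] only if [S] is
    contained in [T]. *)
Lemma support_face_inj a S T : is_support a S -> is_support a T ->
  support_face a S = support_face a T -> S = T.
Proof.
move=> vS vT eqF; apply/eqP; rewrite finset.eqEsubset; apply/andP.
have sub S' T' : is_support a S' -> support_face a S' = support_face a T' -> S' \subset T'.
  move=> /support_realized[x [Px <-]] eqF'; apply/fintype.subsetP => e; rewrite inE.
  apply: contraNT => eT; apply/eqP.
  have : support_face a T' x by rewrite -eqF'; split=> // f; rewrite inE negbK => /eqP.
  by case=> _ ->.
by split; apply: sub.
Qed.

Lemma support_face_nonempty a S : is_support a S -> (support_face a S !=set0)%classic.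
Proof.
move=> /support_realized[x [Px <-]]; exists x; split=> // e.
by rewrite inE negbK => /eqP.
Qed.

(** * The dimension of a support face *)

Definition chosen_edge S v : option E := [pick e in S | etail e == v].
(** Free edges serve as coordinates on the circulations supported in [S]: at each vertex,
    conservation determines the one chosen edge from the others. *)
Definition free_edges S : {set E} := [set e in S | chosen_edge S (etail e) != Some e].

Lemma chosen_edgeP S e : e \in S ->
  exists2 f, chosen_edge S (etail e) = Some f & f \in S /\ etail f = etail e.
Proof.
move=> eS; rewrite /chosen_edge; case: pickP => [f /andP[fS /eqP tf]|/(_ e)].
  by exists f.
by rewrite eS eqxx.
Qed.

Definition circulation_in S z := circulation z /\ forall e, e \notin S -> z e = 0.

(** By induction along edges nothing enters the tail, and the free edges carry nothing, so
    conservation leaves nothing for the chosen edge. *)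
Lemma circulation_unique S z : circulation_in S z ->
  {in free_edges S, forall e, z e = 0} -> forall e, z e = 0.
Proof.
move=> [circ offS] free0; elim/edge_ind => e IH.
case: (boolP (e \in S)) => [eS|/offS//].
case: (boolP (e \in free_edges S)) => [/free0//|].
rewrite inE eS /= negbK => /eqP ce.
have : outflow z (etail e) - inflow z (etail e) = 0 by apply: circ.
rewrite /inflow [X in _ - X]big1 ?subr0; last by move=> f /eqP/IH.
rewrite /outflow (bigD1 e) //= big1 ?addr0 // => f /andP[/eqP tf fe].
case: (boolP (f \in S)) => [fS|/offS//]; apply: free0.
by rewrite inE fS tf ce; apply: contra fe => /eqP[->].
Qed.

(** Each chosen edge carries the inflow at its tail minus the prescribed free outflow. Conservation
    holds at vertices without an outgoing edge in [S] because the support condition lets no edge of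
    [S] enter them. *)
Lemma fundamental_circulation a S f : is_support a S -> f \in free_edges S ->
  exists2 z, circulation_in S z & {in free_edges S, forall e, z e = (e == f)%:R}.
Proof.
move=> valS fF; pose delta e : RR := ((e \in free_edges S) && (e == f))%:R.
(* The free outflow is read off [delta] rather than [z], so the recursion looks only at edges
   entering the tail. *)
pose Phi z e : RR := if e \in S then
  if e \in free_edges S then delta e else inflow z (etail e) - outflow delta (etail e)
  else 0.
have [z zE] : exists z, forall e, z e = Phi z e.
  apply: causal_fixpoint => x y e xy; rewrite /Phi /inflow.
  case: ifP => // _; case: ifP => // _; congr (_ - _).
  by apply: eq_bigr => g /eqP/xy.
have offS e : e \notin S -> z e = 0 by rewrite zE /Phi => /negbTE ->.
exists z; last first.
  by move=> e eF; rewrite zE /Phi eF /delta eF; move: eF; rewrite inE => /andP[->].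
split=> //; apply: (balance_sink z (fun=> 0)) => [|v vs]; first exact: big1.
case: (boolP [exists e in S, etail e == v]) => act; last first.
  have := act; rewrite -(is_supportP a) // negb_or => /andP[_ noin].
  rewrite /outflow /inflow !big1 ?subrr // => e ev; apply: offS.
    by move/existsPn: noin => /(_ e); rewrite ev andbT.
  by move/existsPn: act => /(_ e); rewrite ev andbT.
case/existsP: act => e /andP[eS /eqP te].
have [g cg [gS tg]] := chosen_edgeP _ _ eS; rewrite te in cg tg.
have gF : g \notin free_edges S by rewrite inE gS tg cg eqxx.
apply/eqP; rewrite subr_eq0; apply/eqP.
rewrite /outflow (bigD1 g) /= ?tg // zE /Phi gS (negbTE gF) tg.
rewrite [X in _ + X](_ : _ = outflow delta v) ?subrK //.
rewrite /outflow [RHS](bigD1 g) /= ?tg // [delta g]/delta (negbTE gF) add0r.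
apply: eq_bigr => h /andP[/eqP th hg].
case: (boolP (h \in S)) => hS; last first.
  by rewrite offS // /delta inE (negbTE hS).
have hF : h \in free_edges S.
  by rewrite inE hS th cg; apply: contra hg => /eqP[->].
by rewrite zE /Phi hS hF.
Qed.

(** Each family consists of differences of points of [F], which the other family spans, so the two
    spans coincide. *)
Lemma has_dim_unique (F : set (wvec n m)) k l : has_dim F k -> has_dim F l -> k = l.
Proof.
have sub (s s' : seq (ovec n m)) :
    (forall v : ovec n m, v \in s ->
       exists x y : wvec n m, F x /\ F y /\ v = tov (x - y)) ->
    (forall x y : wvec n m, F x -> F y -> tov (x - y) \in <<s'>>%VS) ->
    (<<s>> <= <<s'>>)%VS.
  move=> gen spans; apply/span_subvP => v /gen[x [y [Fx [Fy ->]]]]; exact: spans.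
case=> s [s1 [s2 <-]] [s' [s'1 [s'2 <-]]]; congr (\dim _).
by apply/eqP; rewrite eqEsubv !sub.
Qed.

Lemma circulation_linear S (I : finType) (P : pred I) (c : I -> RR) (zs : I -> E -> RR) :
  (forall i, P i -> circulation_in S (zs i)) ->
  circulation_in S (fun e => \sum_(i | P i) c i * zs i e).
Proof.
move=> zsP; split=> [v|e eS]; last first.
  by apply: big1 => i /zsP[_ ->] //; rewrite mulr0.
rewrite /outflow /inflow exchange_big /= [X in _ - X]exchange_big /=.
rewrite -sumrB; apply: big1 => i /zsP[circ _].
rewrite -!mulr_sumr -mulrBr.
by have := circ v; rewrite /outflow /inflow => ->; rewrite mulr0.
Qed.

(** Both sides are circulations in [S] that agree on the free edges, so [circulation_unique] applies
    to their difference. *)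
Lemma circulation_expand a S (zs : E -> E -> RR) : is_support a S ->
  (forall f, f \in free_edges S -> circulation_in S (zs f) /\
     {in free_edges S, forall e, zs f e = (e == f)%:R}) ->
  forall z, circulation_in S z ->
  forall e, z e = \sum_(f in free_edges S) z f * zs f e.
Proof.
move=> valS zsP z zS e; apply/eqP; rewrite -subr_eq0; apply/eqP.
(* The difference is written as a combination indexed by [bool], to fall under
   [circulation_linear]. *)
pose c (b : bool) : RR := if b then 1 else -1.
pose w b e := if b then z e else \sum_(f in free_edges S) z f * zs f e.
have circ := @circulation_linear S bool xpredT c w.
have -> : z e - \sum_(f in free_edges S) z f * zs f e = \sum_b c b * w b e.
  by rewrite big_bool /c /w mul1r mulN1r.
move: e; apply: circulation_unique.
  apply: circ => -[] _ //=; apply: circulation_linear => f /zsP[] //.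
move=> e eF; rewrite big_bool /c /w mul1r mulN1r (bigD1 e) //=.
have [_ ->] // := zsP e eF; rewrite eqxx mulr1 big1 ?addr0 ?subrr // => f /andP[fF fe].
by have [_ ->] // := zsP f fF; rewrite eq_sym (negbTE fe) mulr0.
Qed.

(** The fundamental circulations form a basis of the directions. Since [has_dim] asks for
    differences of points of the face, each is scaled so that adding it to a flow with support [S]
    stays in the face. *)
Lemma has_dim_support_face a S : is_support a S ->
  has_dim (support_face a S) #|free_edges S|.
Proof.
move=> valS; have [x0 [Px0 suppx0]] := support_realized _ _ valS.
have x0S e : (x0 e != 0) = (e \in S) by rewrite -suppx0 inE.
have /choice[zs zsP] : forall f, exists z : E -> RR, f \in free_edges S ->
    circulation_in S z /\ {in free_edges S, forall e, z e = (e == f)%:R}.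
  move=> f; case: (boolP (f \in free_edges S)) => [fF|_]; last by exists (fun=> 0).
  by have [z z1 z2] := fundamental_circulation _ _ _ valS fF; exists z.
have /choice[t tP] : forall f, exists t : RR, f \in free_edges S ->
    0 < t /\ forall e, 0 <= x0 e + t * zs f e.
  move=> f; case: (boolP (f \in free_edges S)) => [fF|_]; last by exists 0.
  have [|e|t t0 tP] := small_perturbation x0 (zs f); first by case: Px0.
    apply: contraNneq => xe; have [[_ ->] //] := zsP f fF.
    by rewrite -x0S xe eqxx.
  by exists t.
pose u f : ovec n m := [ffun e => t f * zs f e].
exists [seq u f | f <- enum (free_edges S)]; split; last split.
- move=> v /mapP[f]; rewrite mem_enum => fF ->.
  have [t0 tpos] := tP f fF; have [[circ offS] _] := zsP f fF.
  exists [ffun e => x0 e + t f * zs f e], x0; split; last split.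
  + split; first exact: flow_perturbation.
    move=> e eS; rewrite ffunE offS // mulr0 addr0; apply/eqP.
    by rewrite -[_ == _]negbK x0S.
  + by split=> // e eS; apply/eqP; rewrite -[_ == _]negbK x0S.
  + by apply/ffunP => e; rewrite !ffunE /= addrC addKr.
- move=> x y [Px xS] [Py yS]; pose z e := x e - y e.
  have zS : circulation_in S z.
    split=> [|e eS]; first exact: circulation_diff Px Py.
    by rewrite /z xS // yS // subrr.
  have -> : tov (x - y) = \sum_(f in free_edges S) (z f / t f) *: u f.
    apply/ffunP => e; rewrite sum_ffunE !ffunE -/(z e).
    rewrite (circulation_expand _ _ _ valS zsP _ zS) //; apply: eq_bigr => f fF.
    have [t0 _] := tP f fF; rewrite !ffunE /GRing.scale /= mulrA divfK //.
    by rewrite gt_eqF.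
  apply: rpred_sum => f fF; apply: memvZ; apply: memv_span; apply: map_f.
  by rewrite mem_enum.
- rewrite [RHS]cardE -[RHS](size_map u); apply/eqP; rewrite -/(free _).
  rewrite -[X in free X]in_tupleE; apply/freeP => k sum0 i.
  have szE : size [seq u f | f <- enum (free_edges S)] = size (enum (free_edges S)).
    by rewrite size_map.
  (* A default edge for [nth]; the index [i] witnesses that the list is not empty. *)
  have f0 : E.
    case: (enum (free_edges S)) i {sum0} => [|f0 _ _]; last exact: f0.
    by case.
  pose ei j := nth f0 (enum (free_edges S)) j.
  have eiF j : (j < size [seq u f | f <- enum (free_edges S)])%N -> ei j \in free_edges S.
    by rewrite szE => lt; rewrite -mem_enum mem_nth.
  (* Evaluation at the free edge [ei i] kills every term but the one of index [i]. *)
  have := congr1 (fun w : ovec n m => w (ei i)) sum0.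
  rewrite sum_ffunE ffunE (bigD1 i) //= big1 ?addr0 => [|j ji].
    rewrite ffunE (nth_map f0) -?szE // ffunE -/(ei i).
    have [_ ->] := zsP _ (eiF _ (ltn_ord i)); rewrite ?eiF // eqxx mulr1.
    move/eqP; rewrite mulf_eq0 => /orP[/eqP//|].
    by have [t0 _] := tP _ (eiF _ (ltn_ord i)); rewrite gt_eqF.
  rewrite ffunE (nth_map f0) -?szE // ffunE -/(ei j).
  have [_ ->] := zsP _ (eiF _ (ltn_ord j)); rewrite ?eiF //.
  rewrite nth_uniq ?enum_uniq -?szE // (inj_eq val_inj) eq_sym (negbTE ji).
  by rewrite mulr0 scaler0.
Qed.

Lemma fnum_supports a d :
  @fnum n m a d = #|[set S | is_support a S && (#|free_edges S| == d)]|.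
Proof.
set A := [set S | _]; rewrite /fnum.
have -> : faces_of_dim (flow_polytope a) d =
    [set` [fset support_face a S | S in A]%fset]%classic.
  apply/seteqP; split=> F /=.
    case=> isF [F0 dimF]; have [S valS FE] := face_support _ _ isF F0.
    apply/imfsetP; exists S => //=; rewrite inE valS /=; apply/eqP.
    by apply: has_dim_unique dimF; rewrite FE; apply: has_dim_support_face.
  case/imfsetP => S /=; rewrite inE => /andP[valS /eqP <-] ->; split.
    exact: support_face_is_face.
  by split; [exact: support_face_nonempty | exact: has_dim_support_face].
rewrite set_fsetK card_in_imfset /=; first by rewrite cardE.
move=> S T; rewrite !inE => /andP[vS _] /andP[vT _]; exact: support_face_inj.
Qed.

End FlowPolytope.

(** * Columns and their generating polynomials *)

Section Columns.
Implicit Types (h : bool) (a r d : seq bool).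
Notation Z := {poly int}.

Lemma sum_tuple_cons {T : finType} {R : nmodType} k (P : pred (seq T)) (F : seq T -> R) :
  \sum_(t : k.+1.-tuple T | P t) F t =
  \sum_(c : T) \sum_(t : k.-tuple T | P (c :: t)) F (c :: t).
Proof.
rewrite pair_big_dep /=.
rewrite (reindex (fun p : T * k.-tuple T => [tuple of p.1 :: p.2])) //=.
exists (fun t => (thead t, [tuple of behead t])) => [[c t] _|t _] /=.
  by congr pair; apply: val_inj.
by rewrite [RHS]tuple_eta.
Qed.

Lemma sum_tuple0 {T : finType} {R : nmodType} (P : pred (seq T)) (F : seq T -> R) :
  \sum_(t : 0.-tuple T | P t) F t = if P [::] then F [::] else 0.
Proof.
rewrite big_mkcond (big_pred1 [tuple]) //= => t.
by rewrite [t]tuple0; apply/esym/eqP.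
Qed.

(* Rows of one column of G(n,m): a marks the vertices fed from the left, r the
   edges to the right, d the edges down, and h tells whether the top vertex is
   fed from above. *)
Fixpoint column_ok h a r d : bool :=
  match a, r, d with
  | a0 :: a', r0 :: r', d0 :: d' => (a0 || h == r0 || d0) && column_ok d0 a' r' d'
  | _, _, _ => true
  end.

Definition branchings r d : nat := \sum_(p <- zip r d) (p.1 && p.2).

Definition column_poly (n : nat) h a r : Z :=
  \sum_(d : n.-tuple bool | column_ok h a r d) 'X^(branchings r d).

Lemma column_poly0 h a : column_poly 0 h a [::] = 1.
Proof.
rewrite /column_poly (sum_tuple0 (column_ok h a [::]) (fun d => 'X^(branchings [::] d))).
by rewrite /branchings /= big_nil; case: a.
Qed.

(** In a fed row, a right edge leaves the down edge optional, with weight ['X] if present; without a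
    right edge the down edge is forced. An unfed row has no edges. *)
Lemma column_poly_cons n h (a0 : bool) a (r0 : bool) r :
  column_poly n.+1 h (a0 :: a) (r0 :: r) =
  if a0 || h then
    if r0 then column_poly n false a r + 'X * column_poly n true a r
    else column_poly n true a r
  else if r0 then 0 else column_poly n false a r.
Proof.
rewrite {1}/column_poly (sum_tuple_cons n (column_ok h (a0 :: a) (r0 :: r))
  (fun d => 'X^(branchings (r0 :: r) d))) big_bool /=.
have step (d0 : bool) : \sum_(d : n.-tuple bool | (a0 || h == r0 || d0) && column_ok d0 a r d)
     ('X^(branchings (r0 :: r) (d0 :: d)) : Z) =
   if a0 || h == r0 || d0 then 'X^(r0 && d0) * column_poly n d0 a r else 0.
  case: ifP => _; last exact: big_pred0_eq.
  rewrite /column_poly mulr_sumr; apply: eq_bigr => d _.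
  by rewrite /branchings big_cons exprD.
rewrite !step /column_poly {step}; case: (a0 || h) r0 => [] [] /=;
  by rewrite ?expr1 ?expr0 ?mul1r ?addr0 ?add0r // addrC.
Qed.

Fixpoint one_before_source a r : bool :=
  match a, r with
  | a0 :: a', r0 :: r' => ~~ a0 && (r0 || one_before_source a' r')
  | _, _ => false
  end.

Fixpoint blocks_with_one a r : nat :=
  match a, r with
  | a0 :: a', r0 :: r' => ((a0 && (r0 || one_before_source a' r')) + blocks_with_one a' r')%N
  | _, _ => 0%N
  end.

(** The rows above the first source continue a block begun higher up: if [h] holds they count as one
    more block, otherwise a one among them cannot be fed and the sum is empty. The powers of ['X] on
    the left avoid subtraction in the exponents. *)
Lemma column_polyE n a r : size a = n -> size r = n ->
  let B := blocks_with_one a r in let c := one_before_source a r in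
  column_poly n true a r * 'X^(B + c) = 'X^(count id r) * ('X + 1) ^+ (B + c) /\
  column_poly n false a r * 'X^B = if c then 0 else 'X^(count id r) * ('X + 1) ^+ B.
Proof.
elim: n a r => [|n IH] [|a0 a] [|r0 r] //=.
  by move=> _ _; rewrite !column_poly0 addn0 !expr0 !mulr1.
case=> sa [sr]; have [] := IH a r sa sr.
rewrite !column_poly_cons.
set B := blocks_with_one a r; set c := one_before_source a r.
set W1 := column_poly n true a r; set W0 := column_poly n false a r.
set b := count id r.
have comb : (W0 + 'X * W1) * ('X * 'X^B) = 'X * (W0 * 'X^B) + 'X * (W1 * ('X * 'X^B)).
  ring.
case: a0 r0 => [] []; case: c => /=;
  rewrite ?addn0 ?add0n ?addn1 ?add1n ?exprS ?mul0r => H1 H0 //; split=> //;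
  rewrite comb H0 ?H1 1?[W1 * _]mulrCA ?H1; ring.
Qed.

Lemma column_poly_no_ones n h a : size a = n -> column_poly n h a (nseq n false) = 1.
Proof.
elim: n h a => [|n IH] h [|a0 a] //=; first by rewrite column_poly0.
by case=> sa; rewrite column_poly_cons; case: ifP => _; apply: IH.
Qed.

(** * Summation over the right edges, and signatures *)

Definition column_total n h a : Z := \sum_(r : n.-tuple bool) column_poly n h a r.

Lemma column_total0 h a : column_total 0 h a = 1.
Proof.
by rewrite /column_total (sum_tuple0 xpredT (column_poly 0 h a)) column_poly0.
Qed.

Lemma column_total_cons n h (a0 : bool) a :
  column_total n.+1 h (a0 :: a) =
  if a0 || h then column_total n false a + ('X + 1) * column_total n true a
  else column_total n false a.
Proof.
rewrite /column_total (sum_tuple_cons n xpredT (column_poly n.+1 h (a0 :: a))) big_bool /=.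
under eq_bigr do rewrite column_poly_cons /=.
under [X in _ + X]eq_bigr do rewrite column_poly_cons /=.
case: ifP => _; last by rewrite big1 ?add0r.
by rewrite big_split /= -mulr_sumr mulrDl mul1r addrA.
Qed.

Fixpoint ones_from (k : nat) a : seq nat :=
  if a is a0 :: a' then (if a0 then [:: k] else [::]) ++ ones_from k.+1 a' else [::].

(** The block begun at row [x] is still open at row [k]. Write [Y] for ['X + 1], and [T1], [T0] for
    the totals with and without feed from above. A fed row replaces [T1] by [Y * T1 + T0], so
    [l = k - x] rows give [Y ^+ l * T1] plus [T0] times the geometric sum of the first [l] powers of
    [Y]. Multiplication by ['X = Y - 1] turns that sum into [Y ^+ l - 1]. *)
Lemma column_total_block n a x k : size a = n -> (x <= k)%N ->
  \prod_(c <- pairmap (fun x y => y - x)%N x (rcons (ones_from k a) (k + n)%N))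
     (('X + 1) ^+ c.+1 - 1) =
  'X^(size (ones_from k a)) *
    (('X + 1) ^+ (k - x)%N * 'X * column_total n true a +
     (('X + 1) ^+ (k - x)%N - 1) * column_total n false a).
Proof.
elim: n a x k => [|n IH] [|a0 a] x k //=.
  by rewrite big_seq1 !column_total0 addn0 exprS expr0 => _ _; ring.
case=> sa lexk; rewrite !column_total_cons orbT.
case: a0 => /=; last first.
  rewrite -addSnnS IH // ?leqW // subSn // exprS; ring.
rewrite big_cons -addSnnS IH // subSnn expr1 !exprS; ring.
Qed.

Definition signature_from n k a : seq nat :=
  if ones_from k a is x1 :: rest
  then pairmap (fun x y => y - x)%N x1 (rcons rest (k + n)%N) else [::].

(** Rows before the first source contribute nothing; at that source [column_total_block] applies
    with a block of one row already open. Each block yields one factor ['X], which accounts for the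
    shift of the coefficient by the length of the signature. *)
Lemma column_total_signature n a k : size a = n ->
  \prod_(c <- signature_from n k a) (('X + 1) ^+ c.+1 - 1) =
  'X^(size (signature_from n k a)) * column_total n false a.
Proof.
rewrite /signature_from; elim: n a k => [|n IH] [|a0 a] k //=.
  by rewrite big_nil expr0 column_total0 mulr1.
case=> sa; rewrite column_total_cons orbF -addSnnS; case: a0; last exact: IH.
rewrite column_total_block // subSnn expr1 size_pairmap size_rcons exprS; ring.
Qed.

(** * Sequences of columns *)

Definition column n := (n.-tuple bool * n.-tuple bool)%type.

(** The right edges of a column are the feed of the next; the final test says that no right edge
    leaves the last column. *)
Fixpoint grid_ok {n} a (s : seq (column n)) : bool :=
  if s is c :: s' then column_ok false a c.1 c.2 && grid_ok c.1 s' else all negb a.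

Definition grid_branchings {n} (s : seq (column n)) : nat :=
  \sum_(c <- s) branchings c.1 c.2.

Definition grid_poly n k a : Z :=
  \sum_(t : k.-tuple (column n) | grid_ok a t) 'X^(grid_branchings t).

Lemma grid_polyS n k a :
  grid_poly n k.+1 a =
  \sum_(r : n.-tuple bool) column_poly n false a r * grid_poly n k r.
Proof.
rewrite /grid_poly (sum_tuple_cons k (grid_ok a) (fun t => 'X^(grid_branchings t))).
under [RHS]eq_bigr do rewrite /column_poly mulr_suml.
rewrite [RHS]pair_big_dep /= [RHS]big_mkcond /=; apply: eq_bigr => -[r d] _ /=.
case: ifP => _; last exact: big_pred0_eq.
by rewrite mulr_sumr; apply: eq_bigr => t _; rewrite /grid_branchings big_cons exprD.
Qed.

(** A single column has no right edges, so all flow runs straight down and nothing branches. *)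
Lemma grid_poly1 n a : size a = n -> grid_poly n 1 a = 1.
Proof.
move=> sa; rewrite grid_polyS (bigD1 [tuple of nseq n false]) //=.
have gp0 (r : seq bool) : grid_poly n 0 r = (all negb r)%:R.
  rewrite /grid_poly (sum_tuple0 (grid_ok r) (fun t => 'X^(grid_branchings t))) /=.
  by rewrite /grid_branchings big_nil; case: all.
rewrite gp0 all_nseq orbT mulr1 column_poly_no_ones // big1 ?addr0 // => r rn.
rewrite gp0; case: (boolP (all negb r)) => [r0|_]; last by rewrite mulr0.
case/eqP: rn; apply: val_inj; apply/eqP => /=; rewrite -{2}(size_tuple r).
by apply/eqP/all_pred1P; apply: sub_all r0 => -[].
Qed.

Lemma grid_poly2 n a : grid_poly n 2 a = column_total n false a.
Proof.
rewrite grid_polyS; apply: eq_bigr => r _.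
by rewrite grid_poly1 ?mulr1 ?size_tuple.
Qed.

End Columns.

(** * Supports as sequences of columns *)

Lemma column_okP n h (a r d : seq bool) : size a = n -> size r = n -> size d = n ->
  reflect (forall i, (i < n)%N ->
     nth false a i || nth false (h :: d) i = nth false r i || nth false d i)
    (column_ok h a r d).
Proof.
elim: n h a r d => [|n IH] h [|a0 a] [|r0 r] [|d0 d] //=; first by move=> *; left.
move=> [sa] [sr] [sd]; apply: (iffP andP) => [[/eqP ok0 /IH ok] [|i] //= lti|ok].
  exact: ok.
by split; [apply/eqP; apply: (ok 0%N) | apply/IH => // i lti; apply: (ok i.+1)].
Qed.

Lemma grid_okP n a (s : seq (column n)) (c0 : column n) :
  reflect ((forall j, (j < size s)%N ->
      column_ok false (nth [::] (a :: [seq val c.1 | c <- s]) j)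
        (nth c0 s j).1 (nth c0 s j).2) /\
     all negb (last a [seq val c.1 | c <- s]))
   (grid_ok a s).
Proof.
elim: s a => [|c s IH] a /=.
  by apply: (iffP idP) => [|[]].
apply: (iffP andP) => [[okc /IH[oks lasts]]|[ok lasts]].
  by split=> // -[|j] //= ltj; apply: oks.
split; first exact: (ok 0%N).
by apply/IH; split=> // j ltj; apply: (ok j.+1).
Qed.

Lemma nth_mktuple_nat T (x0 : T) n (f : nat -> T) k : (k < n)%N ->
  nth x0 [tuple f i | i < n] k = f k.
Proof. by move=> ltk; rewrite -[k]/(val (Ordinal ltk)) nth_mktuple. Qed.

Section GridEncoding.
Context {n m : nat}.
Notation E := (gedge n m).
Notation V := (gvertex n m).
Implicit Types (e f : E) (v : V) (S T : {set E}).

(* (i, j, b) stands for the edge leaving (i, j) downwards if b, to the right otherwise. *)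
Definition edge_code e : nat * nat * bool :=
  match val e with
  | (Some (i, j), Some (i', j')) => (nat_of_ord i, nat_of_ord j, i' != i)
  | (Some (i, j), None) => (nat_of_ord i, nat_of_ord j, true)
  | _ => (0%N, 0%N, false)
  end.

Lemma etail_code e (i : 'I_n) (j : 'I_m.+1) : (etail e == Some (i, j)) =
  (edge_code e == (i : nat, j : nat, false)) || (edge_code e == (i : nat, j : nat, true)).
Proof.
case: e => [[[[i1 j1]|] [[k l]|]] ge] //; rewrite /etail /edge_code /= !xpair_eqE.
- by rewrite -andb_orr; case: (k != i1); rewrite /= andbT.
- by rewrite andbF andbT.
Qed.

Lemma ehead_code e (i : 'I_n) (j : 'I_m.+1) : (ehead e == Some (i, j)) =
  ((0 < j)%N && (edge_code e == (i : nat, j.-1, false))) ||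
  ((0 < i)%N && (edge_code e == (i.-1, j : nat, true))).
Proof.
case: e => [[[[i1 j1]|] [[k l]|]] ge] //; rewrite /ehead /edge_code /= !xpair_eqE.
- move: ge => /=; rewrite -[Some _ == _]/((k == i) && (l == j)) eqbF_neg eqb_id negbK.
  rewrite -!val_eqE /=; lia.
- rewrite -[None == _]/false /= andbF andbT; move: ge => /= /eqP; have := ltn_ord i; lia.
Qed.

(** The code determines which vertices are tail and head, and an edge is the pair of its ends. *)
Lemma edge_code_inj : injective edge_code.
Proof.
move=> e e' eqc; have eqt : etail e = etail e'.
  case t: (etail e) (etail_neq_sink e) => [[i j]|] // _.
  by apply/esym/eqP; rewrite etail_code -eqc -etail_code t.
have eqh : ehead e = ehead e'.
  case h: (ehead e) => [[i j]|].
    by apply/esym/eqP; rewrite ehead_code -eqc -ehead_code h.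
  case h': (ehead e') => [[i j]|] //.
  by move/eqP: h'; rewrite ehead_code -eqc -ehead_code h.
by apply: val_inj; rewrite [val e]surjective_pairing [val e']surjective_pairing; congr pair.
Qed.

Lemma edge_code_bound e i j b : edge_code e = (i, j, b) ->
  [/\ (i < n)%N, (j <= m)%N & b || (j < m)%N].
Proof.
case: e => [[[[i1 j1]|] [[k l]|]] ge] //; rewrite /edge_code /= => -[<- <- <-]; split=> //.
- by rewrite -ltnS.
- by move: ge => /=; rewrite -!val_eqE /=; have := ltn_ord l; lia.
- by rewrite -ltnS.
Qed.

Lemma edge_code_surj i j (b : bool) : (i < n)%N -> (j <= m)%N -> b || (j < m)%N ->
  exists e, edge_code e = (i, j, b).
Proof.
move=> lti lej; pose i0 : 'I_n := Ordinal lti.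
pose j0 : 'I_m.+1 := Ordinal (lej : (j < m.+1)%N).
case: b => /= ltj; last first.
  have ge : is_gedge (Some (i0, j0), Some (i0, Ordinal (ltj : (j.+1 < m.+1)%N))).
    by rewrite /= !eqxx.
  by exists (Sub _ ge : E); rewrite /edge_code /= eqxx.
have [lt|ge] := ltnP i.+1 n.
  have ge : is_gedge (Some (i0, j0), Some (Ordinal lt, j0)) by rewrite /= !eqxx orbT.
  exists (Sub _ ge : E); rewrite /edge_code /=; congr (_, _, _).
  by rewrite -val_eqE /=; lia.
have ge' : is_gedge (Some (i0, j0), None : V) by rewrite /=; lia.
by exists (Sub _ ge' : E).
Qed.

Definition has_code S c := [exists e in S, edge_code e == c].

Lemma exists_etail_code S (i : 'I_n) (j : 'I_m.+1) :
  [exists e in S, etail e == Some (i, j)] =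
  has_code S (i : nat, j : nat, false) || has_code S (i : nat, j : nat, true).
Proof.
apply/existsP/orP => [[e /andP[eS]]|].
  by rewrite etail_code => /orP[] ec; [left|right]; apply/existsP; exists e; rewrite eS.
by case=> /existsP[e /andP[eS ec]]; exists e; rewrite eS etail_code ec ?orbT.
Qed.

Lemma exists_ehead_code S (i : 'I_n) (j : 'I_m.+1) :
  [exists e in S, ehead e == Some (i, j)] =
  ((0 < j)%N && has_code S (i : nat, j.-1, false)) ||
  ((0 < i)%N && has_code S (i.-1, j : nat, true)).
Proof.
apply/existsP/orP => [[e /andP[eS]]|].
  rewrite ehead_code => /orP[] /andP[-> ec]; [left|right];
  by apply/existsP; exists e; rewrite eS.
by case=> /andP[pos /existsP[e /andP[eS ec]]]; exists e; rewrite eS ehead_code pos ec ?orbT.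
Qed.

(** * The bijection between supports and admissible grids *)

Definition grid_of S : m.+1.-tuple (column n) :=
  [tuple ([tuple has_code S (i : nat, j : nat, false) | i < n],
          [tuple has_code S (i : nat, j : nat, true) | i < n]) | j < m.+1].

Lemma nth_grid_of S c0 j : (j <= m)%N -> nth c0 (grid_of S) j =
  ([tuple has_code S (i : nat, j, false) | i < n], [tuple has_code S (i : nat, j, true) | i < n]).
Proof.
by move=> lej; rewrite (nth_mktuple_nat _ c0 m.+1 (fun j =>
  ([tuple has_code S (i : nat, j, false) | i < n],
   [tuple has_code S (i : nat, j, true) | i < n]))).
Qed.

Definition source_row (a : 'I_n -> nat) : n.-tuple bool := [tuple (0 < a i)%N | i < n].

(** The support condition at [(i, j)] is the condition on row [i] of column [j]. The feed from the
    left is the source row when [j] is 0 and otherwise the right edges of the preceding column. *)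
Lemma is_support_grid a S : grid_ok (source_row a) (grid_of S) = is_support a S.
Proof.
pose c0 : column n := ([tuple false | i < n], [tuple false | i < n]).
have left_nth (i : 'I_n) j : (j <= m)%N ->
  nth false (nth [::] (val (source_row a) :: [seq val c.1 | c <- grid_of S]) j) i =
  (j == 0%N) && (0 < a i)%N || (0 < j)%N && has_code S (i : nat, j.-1, false).
  case: j => [|j] ltj; first by rewrite /= orbF nth_mktuple.
  rewrite -[nth [::] _ j.+1]/(nth [::] [seq val c.1 | c <- grid_of S] j).
  rewrite (nth_map c0); last by rewrite size_tuple; apply: ltnW.
  rewrite nth_grid_of; last exact: ltnW.
  by rewrite nth_mktuple.
have left_size j : (j <= m)%N ->
  size (nth [::] (val (source_row a) :: [seq val c.1 | c <- grid_of S]) j) = n.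
  case: j => [|j] ltj; first by rewrite size_tuple.
  rewrite -[nth [::] _ j.+1]/(nth [::] [seq val c.1 | c <- grid_of S] j).
  rewrite (nth_map c0); last by rewrite size_tuple; apply: ltnW.
  by rewrite size_tuple.
have up_nth (i : 'I_n) j :
  nth false (false :: [tuple has_code S (k : nat, j, true) | k < n]) i =
  (0 < i)%N && has_code S (i.-1, j, true).
  case: i => -[|i] lti //.
  rewrite -[LHS]/(nth false [tuple has_code S (k : nat, j, true) | k < n] i).
  by rewrite (nth_mktuple_nat _ _ _ (fun k => has_code S (k, j, true))) // ltnW.
apply/(grid_okP _ _ _ c0)/forallP.
  case=> ok _ [[i j]|//]; apply/implyP => _; apply/eqP.
  rewrite exists_etail_code exists_ehead_code.
  have lej : (j <= m)%N by rewrite -ltnS.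
  have := ok j; rewrite size_tuple ltn_ord => /(_ isT).
  rewrite nth_grid_of // => /column_okP-/(_ n).
  rewrite !size_tuple left_size // => /(_ erefl erefl erefl i (ltn_ord i)).
  by rewrite left_nth // up_nth !nth_mktuple orbA.
move=> ok; split=> [j|].
  rewrite size_tuple ltnS => lej; rewrite nth_grid_of //.
  apply/(column_okP n); rewrite ?size_tuple ?left_size // => i lti.
  have := ok (Some (Ordinal lti, Ordinal (lej : (j < m.+1)%N))).
  move=> /implyP/(_ isT)/eqP; rewrite exists_etail_code exists_ehead_code /=.
  rewrite (left_nth (Ordinal lti)) // (up_nth (Ordinal lti)) -orbA.
  rewrite (nth_mktuple_nat _ _ _ (fun k => has_code S (k, j, false))) //.
  by rewrite (nth_mktuple_nat _ _ _ (fun k => has_code S (k, j, true))).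
(* The last column has no right edges, since their codes would violate [edge_code_bound]. *)
rewrite -nth_last size_map size_tuple (nth_map c0) ?size_tuple //.
rewrite nth_grid_of //; apply/allP => b /mapP[i _ ->]; apply/negP => /existsP[e /andP[_ /eqP]].
by move/edge_code_bound => []; rewrite ltnn.
Qed.

Lemma grid_of_inj : injective grid_of.
Proof.
move=> S T eqST; apply/setP => e; case c: (edge_code e) => [[i j] b].
have [lti lej _] := edge_code_bound _ _ _ _ c.
have mem_code (U : {set E}) : (e \in U) = has_code U (i, j, b).
  apply/idP/existsP => [eU|[f /andP[fU /eqP]]]; first by exists e; rewrite eU c /=.
  by rewrite -c => /edge_code_inj <-.
pose c0 : column n := ([tuple false | i < n], [tuple false | i < n]).
pose cell (t : m.+1.-tuple (column n)) :=
  nth false (if b then val (nth c0 t j).2 else val (nth c0 t j).1) i.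
have cellE U : cell (grid_of U) = has_code U (i, j, b).
  rewrite /cell nth_grid_of //; case: (b).
    exact: (nth_mktuple_nat _ _ _ (fun k => has_code U (k, j, true))).
  exact: (nth_mktuple_nat _ _ _ (fun k => has_code U (k, j, false))).
by rewrite !mem_code -!cellE eqST.
Qed.

(** Every cell is the code of an edge except a right edge out of the last column, and [grid_ok]
    leaves those cells empty. *)
Lemma grid_of_surj a (t : m.+1.-tuple (column n)) : grid_ok a t ->
  exists S, grid_of S = t.
Proof.
pose c0 : column n := ([tuple false | i < n], [tuple false | i < n]).
move/(grid_okP _ _ _ c0) => [_].
rewrite -nth_last size_map size_tuple (nth_map c0) ?size_tuple //= => last0.
pose val_at i j (b : bool) := let c := nth c0 t j in nth false (if b then c.2 else c.1) i.
pose S := [set e | let: (i, j, b) := edge_code e in val_at i j b].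
have SE i j b : (i < n)%N -> (j <= m)%N -> has_code S (i, j, b) = val_at i j b.
  move=> lti lej; apply/existsP/idP => [[e]|v].
    by rewrite inE => /andP[vb /eqP ec]; rewrite ec in vb.
  have [e ec] : exists e, edge_code e = (i, j, b).
    apply: edge_code_surj => //; case: b v => //= v.
    move: lej; rewrite leq_eqVlt => /orP[/eqP ej|//].
    move/all_nthP: last0 => /(_ false i); rewrite size_tuple => /(_ lti).
    by move: v; rewrite ej /val_at /= => ->.
  by exists e; rewrite inE ec v eqxx.
exists S; apply: val_inj; apply: (@eq_from_nth _ c0); rewrite !size_tuple // => j ltj.
rewrite nth_grid_of // [RHS]surjective_pairing; congr pair; apply: val_inj;
  apply: (@eq_from_nth _ false); rewrite !size_tuple // => i lti.
  by rewrite (nth_mktuple_nat _ _ _ (fun k => has_code S (k, j, false))) // SE.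
by rewrite (nth_mktuple_nat _ _ _ (fun k => has_code S (k, j, true))) // SE.
Qed.

(** A vertex with an outgoing edge in [S] has one free edge fewer than its outdegree, which is at
    most two. *)
Lemma card_free_edges S : #|free_edges S| =
  (\sum_(j < m.+1) \sum_(i < n)
     (has_code S (i : nat, j : nat, false) && has_code S (i : nat, j : nat, true)))%N.
Proof.
pose outdeg v := #|[set e in S | etail e == v]|.
have code_count c : has_code S c = (\sum_(e in S) (edge_code e == c))%N :> nat.
  have [/existsP[e /andP[eS /eqP ec]]|/existsPn no] := boolP (has_code S c).
    rewrite (bigD1 e) //= ec eqxx big1 // => f /andP[_ fe].
    by rewrite -ec (inj_eq edge_code_inj) (negbTE fe).
  by rewrite big1 // => e eS; have := no e; rewrite eS /= => /negbTE ->.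
have outdegE i j : outdeg (Some (i, j)) =
    (has_code S (i : nat, j : nat, false) + has_code S (i : nat, j : nat, true))%N.
  rewrite !code_count -big_split /= /outdeg -sum1dep_card big_mkcondr /=.
  apply: eq_bigr => e _; rewrite etail_code.
  by case: eqP => [->|_]; case: eqP.
(* The truncated predecessor gives 0 at vertices without outgoing edges in [S]. *)
have freedeg v : #|[set e in free_edges S | etail e == v]| = (outdeg v).-1.
  case cv: (chosen_edge S v) => [g|]; last first.
    have out0 : [set e in S | etail e == v] = finset.set0.
      apply/setP => e; rewrite !inE; apply/negP => /andP[eS /eqP te].
      by have [f] := chosen_edgeP _ _ eS; rewrite te cv.
    rewrite /outdeg out0 cards0; apply/eqP; rewrite cards_eq0 -finset.subset0 -out0.
    by apply/fintype.subsetP => e; rewrite !inE => /andP[/andP[-> _] ->].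
  have /andP[gS tg] : (g \in S) && (etail g == v).
    by move: cv; rewrite /chosen_edge; case: pickP => // h hP [<-].
  rewrite /outdeg (cardsD1 g [set e in S | _]) inE gS tg /=; apply: eq_card => e.
  rewrite !inE; case: (eqVneq (etail e) v) => [te|]; last by rewrite !andbF.
  by rewrite te cv !andbT andbC (inj_eq Some_inj) eq_sym.
rewrite -sum1_card (partition_big (@etail n m) xpredT) //=.
rewrite (bigD1 None) //= big_pred0 => [|e]; last by rewrite (negbTE (etail_neq_sink e)) andbF.
rewrite add0n.
rewrite (reindex_omap (fun p : 'I_n * 'I_m.+1 => Some p) id); last by case.
rewrite exchange_big /= pair_bigA /=; apply: eq_big => [p|[i j] _]; first by rewrite eqxx.
rewrite sum1dep_card freedeg outdegE.
by case: has_code; case: has_code.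
Qed.

Lemma branchings_grid S : grid_branchings (grid_of S) = #|free_edges S|.
Proof.
rewrite card_free_edges /grid_branchings big_tuple; apply: eq_bigr => j _.
rewrite tnth_mktuple /branchings (big_nth (false, false)) size_zip !size_tuple.
rewrite minnn big_mkord; apply: eq_bigr => i _.
by rewrite nth_zip ?size_tuple // !nth_mktuple.
Qed.

Lemma fnum_grid a d : (@fnum n m a d)%:Z = (grid_poly n m.+1 (source_row a))`_d.
Proof.
rewrite fnum_supports -(card_imset _ grid_of_inj) /grid_poly coef_sum.
rewrite -sum1_card -natz natr_sum big_mkcond [RHS]big_mkcond /=; apply: eq_bigr => t _.
rewrite coefXn; have [ok|nok] := boolP (grid_ok _ _); last first.
  case: ifP => // /imsetP[S]; rewrite inE -is_support_grid => /andP[ok _] tS.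
  by rewrite tS ok in nok.
have [S tS] := grid_of_surj _ _ ok; rewrite -tS mem_imset; last exact: grid_of_inj.
by rewrite inE -is_support_grid tS ok -tS branchings_grid eq_sym; case: eqP.
Qed.

End GridEncoding.

(** * Blocks and signatures *)

Lemma exists_ordS n (P : pred 'I_n.+1) :
  [exists i, P i] = P ord0 || [exists i : 'I_n, P (lift ord0 i)].
Proof.
apply/existsP/orP => [[i]|[P0|/existsP[i Pi]]]; [|by exists ord0|by exists (lift ord0 i)].
by case: (unliftP ord0 i) => [k ->|->] Pi; [right; apply/existsP; exists k|left].
Qed.

Lemma forall_ordS n (P : pred 'I_n.+1) :
  [forall i, P i] = P ord0 && [forall i : 'I_n, P (lift ord0 i)].
Proof.
apply/forallP/andP => [Pi|[P0 /forallP Pi] i]; last by case: (unliftP ord0 i) => [k ->|->].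
by split=> //; apply/forallP.
Qed.

Definition row_seq {n} (f : 'I_n -> bool) : seq bool := [seq f i | i <- enum 'I_n].

Lemma row_seqS n (f : 'I_n.+1 -> bool) :
  row_seq f = f ord0 :: row_seq (fun i => f (lift ord0 i)).
Proof. by rewrite /row_seq enum_ordSl /= -map_comp. Qed.

Lemma row_seq0 (f : 'I_0 -> bool) : row_seq f = [::].
Proof. by apply: size0nil; rewrite size_map size_enum_ord. Qed.

Lemma one_before_sourceE n (a : 'I_n -> nat) (f : 'I_n -> bool) :
  one_before_source (row_seq (fun i => (0 < a i)%N)) (row_seq f) =
  [exists i, f i && [forall q : 'I_n, (q <= i)%N ==> (a q == 0%N)]].
Proof.
elim: n a f => [|n IH] a f.
  by rewrite row_seq0; apply/esym/negbTE/existsPn => -[].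
rewrite !row_seqS /= IH exists_ordS forall_ordS /= -eqn0Ngt andb_orr.
congr (_ || _).
  rewrite andbC; congr (_ && _); rewrite [X in _ && X](_ : _ = true) ?andbT //.
  exact/forallP.
have [a0|a0] /= := eqVneq (a ord0) 0%N; last first.
  by apply/esym/negbTE/existsPn => i; rewrite forall_ordS /= (negbTE a0) andbF.
by apply: eq_existsb => i; rewrite forall_ordS /= a0 /=.
Qed.

(** [beta] and [bones] are cardinals of classical sets; as sums, their first row can be split
    off. *)
Lemma card_classical (T : finType) (P : pred T) :
  #|[set x : T | P x]%classic| = (\sum_(x : T) P x)%N.
Proof.
rewrite -sum1_card big_mkcond; apply: eq_bigr => x _.
have -> : (x \in [set x : T | P x]%classic) = P x by apply/idP/idP; rewrite inE.
by case: (P x).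
Qed.

(** When row 0 is a source, its block contains a one exactly if row 0 is a one or a one occurs
    before the next source, which is the test made by [blocks_with_one]. *)
Lemma blocks_with_oneE n (a : 'I_n -> nat) (j : {ffun 'I_n -> bool}) :
  blocks_with_one (row_seq (fun i => (0 < a i)%N)) (row_seq j) = beta j a.
Proof.
rewrite /beta card_classical.
(* A plain function replaces the finite function, so that the induction can shift its argument. *)
move: (j : 'I_n -> bool) => f {j}.
elim: n a f => [|n IH] a f; first by rewrite row_seq0 big_ord0.
rewrite !row_seqS /= IH big_ord_recl /=; congr (_ + _)%N.
  rewrite exists_ordS one_before_sourceE.
  have -> : inblock a ord0 ord0.
    by apply/forallP => q; case: q => -[].
  rewrite andbT; set u := [exists _, _]; set v := [exists _, _].
  have -> // : u = v.
    apply: eq_existsb => i; rewrite /inblock forall_ordS /=.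
    by congr (_ && _); apply: eq_forallb => q.
(* Row 0 lies in no block starting further down. *)
apply: eq_bigr => p _; rewrite exists_ordS /inblock /= andbF /=.
set u := [exists _, _]; set v := [exists _, _].
have -> // : u = v.
apply: eq_existsb => i; congr (_ && (_ && _)).
by rewrite forall_ordS.
Qed.

Lemma bonesE n (j : {ffun 'I_n -> bool}) : bones j = count id (row_seq j).
Proof.
rewrite /bones card_classical -sum1_count [RHS]big_mkcond /= [RHS]big_map [RHS]big_enum /=.
by apply: eq_bigr => i _; case: (j i).
Qed.

Lemma ones_fromE n (f : 'I_n -> bool) k :
  ones_from k (row_seq f) = [seq (k + i)%N | i : 'I_n <- enum 'I_n & f i].
Proof.
elim: n f k => [|n IH] f k; first by rewrite row_seq0 [enum _]size0nil ?size_enum_ord.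
have shift : [seq (k.+1 + i)%N | i : 'I_n <- enum 'I_n & f (lift ord0 i)] =
    [seq (k + i)%N | i : 'I_n.+1 <- map (lift ord0) (enum 'I_n) & f i].
  rewrite filter_map -map_comp; apply: eq_map => i /=.
  by rewrite /bump /= add1n addnS addSn.
rewrite row_seqS enum_ordSl /= IH shift; case: (f ord0) => //=.
by rewrite addn0.
Qed.

Lemma sgnE n (j : {ffun 'I_n -> bool}) : sgn j = signature_from n 0 (row_seq j).
Proof. by rewrite /signature_from ones_fromE add0n. Qed.

(** Each block counted holds at least one 1; this makes the natural subtraction for [gamma]
    exact. *)
Lemma blocks_le_ones (a r : seq bool) :
  (one_before_source a r + blocks_with_one a r <= count id r)%N.
Proof. elim: a r => [|[] a IH] [|[] r] //=; have := IH r; lia. Qed.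

(** * Extraction of coefficients and conclusion *)

(** The form matches the recursion to be proved: [k] runs up to [d] for any [b], as the binomials
    vanish beyond [b], and the explicit 0 mirrors [fnumZ] at negative indices. *)
Lemma coef_column_product (g b d : nat) (Q : {poly int}) :
  ('X^g * ('X + 1) ^+ b * Q)`_d =
  \sum_(0 <= k < d.+1) 'C(b, k)%:R * (if (g + k <= d)%N then Q`_(d - (g + k)) else 0).
Proof.
rewrite -mulrA coefXnM; case: ltnP => [ltdg|legd].
  rewrite big_nat big1 // => k _; rewrite ifF ?mulr0 //; lia.
have coefX1 k : (('X + 1 : {poly int}) ^+ b)`_k = 'C(b, k)%:R.
  have -> : ('X + 1 : {poly int}) ^+ b = \poly_(i < b.+1) 'C(b, i)%:R.
    rewrite addrC exprDn poly_def; apply: eq_bigr => i _.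
    by rewrite expr1n mul1r -scaler_nat.
  by rewrite coef_poly ltnS; case: leqP => // lt; rewrite bin_small.
(* The terms with [k] above [d - g] vanish, and the remaining ones form the convolution. *)
rewrite coefM (big_cat_nat (n := (d - g).+1)) //=; last by rewrite ltnS leq_subr.
rewrite [X in _ = _ + X]big_nat [X in _ = _ + X]big1 ?addr0 => [|k kd]; last first.
  by rewrite ifF ?mulr0 //; lia.
rewrite big_mkord; apply: eq_bigr => k _; rewrite coefX1.
have lek := ltn_ord k; rewrite ifT; last by lia.
by congr (_ * _`_ _); lia.
Qed.

(** With a source in the first row nothing precedes the first source, so the second part of
    [column_polyE] is nonzero and ['X^B] can be cancelled. *)
Lemma column_poly_closed n (a r : seq bool) : size (true :: a) = n -> size r = n ->
  let B := blocks_with_one (true :: a) r in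
  column_poly n false (true :: a) r = 'X^(count id r - B) * ('X + 1) ^+ B.
Proof.
move=> sa sr B; have [_] := column_polyE n _ _ sa sr.
have := blocks_le_ones (true :: a) r; rewrite -/B.
have -> : one_before_source (true :: a) r = false by case: (r).
rewrite add0n => leB.
have XB : ('X^B : {poly int}) != 0 by rewrite monic_neq0 ?monicXn.
move=> H; apply: (mulIf XB); rewrite H -[in LHS](subnK leB) exprD; ring.
Qed.

Lemma sum_rows n {R : nmodType} (F : n.-tuple bool -> R) :
  \sum_(r : n.-tuple bool) F r = \sum_(j : {ffun 'I_n -> bool}) F [tuple j i | i < n].
Proof.
rewrite (reindex (fun j : {ffun 'I_n -> bool} => [tuple j i | i < n])) //=.
exists (fun r : n.-tuple bool => [ffun i => tnth r i]) => [j _|r _].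
  by apply/ffunP => i; rewrite ffunE tnth_mktuple.
by apply: eq_from_tnth => i; rewrite tnth_mktuple ffunE.
Qed.

Lemma fnum_natv n m (j : {ffun 'I_n -> bool}) e :
  (@fnum n m (natv j) e)%:Z = (grid_poly n m.+1 [tuple j i | i < n])`_e.
Proof.
rewrite fnum_grid; congr ((grid_poly _ _ (val _))`_ _).
by apply: eq_from_tnth => i; rewrite !tnth_mktuple /natv; case: (j i).
Qed.

Theorem theorem6p5 (n m : nat) (a : 'I_n -> nat) (d : nat) :
  (0 < n)%N -> (0 < m)%N ->
  (forall i : 'I_n, nat_of_ord i = 0%N -> (0 < a i)%N) ->
  (d <= n * m)%N ->
  ((1 < m)%N ->
     @fnum n m a d =
     (\sum_(j : {ffun 'I_n -> bool}) \sum_(0 <= k < d.+1)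
        'C(beta j a, k) * @fnumZ n m.-1 (natv j) (d%:Z - k%:Z - gamma j a)%R)%N) /\
  (m = 1%N ->
     forall j : {ffun 'I_n -> bool},
       ((@fnum n 1 (natv j) d)%:Z =
        (\prod_(c <- sgn j) (('X + 1) ^+ c.+1 - 1) : {poly int})`_(d + size (sgn j)))%R).
Proof.
case: n a => // n a _ m_gt0 a0 _; split=> [m_gt1|_ j]; last first.
  rewrite fnum_natv sgnE column_total_signature; last by rewrite size_map size_enum_ord.
  (* The power of ['X] brings the coefficient back to index [d], and for [m = 1] there are two
     columns. *)
  by rewrite coefXnM ltnNge leq_addl addnK grid_poly2.
case: m m_gt0 m_gt1 => // m _ _ /=.
apply/eqP; rewrite -eqz_nat; apply/eqP.
(* The first column is split off; the others form a grid for [m - 1] whose sources are its right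
   edges [j]. *)
rewrite fnum_grid grid_polyS coef_sum sum_rows -[RHS]natz natr_sum; apply: eq_bigr => j _.
have rowE : val (source_row a) = true :: row_seq (fun i => (0 < a (lift ord0 i))%N).
  by rewrite -[LHS]/(row_seq (fun i => (0 < a i)%N)) row_seqS a0.
have rowjE : val [tuple j i | i < n.+1] = row_seq j by [].
rewrite rowE column_poly_closed; [|by rewrite -rowE size_tuple|by rewrite size_tuple].
rewrite -rowE -[val (source_row a)]/(row_seq (fun i => (0 < a i)%N)) {1 2 3}rowjE.
rewrite blocks_with_oneE -bonesE coef_column_product natr_sum; apply: eq_bigr => k _.
rewrite natrM; congr (_ * _).
have leB : (beta j a <= bones j)%N.
  rewrite -blocks_with_oneE bonesE; apply: leq_trans (blocks_le_ones _ _).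
  exact: leq_addl.
(* Either the index is a natural number, or it is negative and [fnumZ] is 0 there. *)
case: leqP => cmp.
  have -> : (d%:Z - k%:Z - gamma j a)%R = (d - (bones j - beta j a + k))%N :> int.
    rewrite /gamma; lia.
  by rewrite /= natz fnum_natv.
have [l ->] : exists l, (d%:Z - k%:Z - gamma j a)%R = Negz l.
  exists (bones j - beta j a + k - d).-1%N; rewrite /gamma; lia.
by [].
Qed.
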